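(* Let $\Lambda$ be an admissible set of algebraically independent numbers (in the sense defined in the context) such that $$\limsup_{n\to\infty}\frac{\#(\Lambda\cap[0,n))}{n}=\infty.$$ Then every admissible set containing $\Lambda$ is type 2.
   Context: Convention: a set of (distinct) real numbers $\{\alpha_1,\alpha_2,\dots\}$ is said to consist of algebraically independent numbers if for each $N\in\mathbb{N}$, whenever $k_1,\dots,k_N\in\mathbb{Z}$ and $k_1\alpha_1+\dots+k_N\alpha_N=0$, then $k_1=\dots=k_N=0$ (that is, the numbers are linearly independent over $\mathbb{Q}$). $\#A$ denotes the cardinality of $A$. A set $\Lambda\subset\mathbb{R}$ is called admissible if it is countably infinite, unbounded, bounded from below, and has no finite accumulation points. Let $\mu$ denote Lebesgue measure on $\mathbb{R}$. For an admissible $\Lambda$ and a (Lebesgue) measurable $f:\mathbb{R}\to[0,+\infty)$, put $s(x)=\sum_{\lambda\in\Lambda}f(x+\lambda)$, $C(f,\Lambda)=\{x\in\mathbb{R}: s(x)<\infty\}$ and $D(f,\Lambda)=\{x\in\mathbb{R}: s(x)=\infty\}$. The set $\Lambda$ is type 1 if for every measurable $f:\mathbb{R}\to[0,+\infty)$ either $\mu(D(f,\Lambda))=0$ or $\mu(C(f,\Lambda))=0$. Otherwise $\Lambda$ is type 2. *)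

(* Defs.v *)
From HB Require Import structures.
From mathcomp Require Import all_boot all_order all_algebra.
From mathcomp Require Import all_classical all_reals all_analysis.
Set Implicit Arguments.
Unset Strict Implicit.
Unset Printing Implicit Defensive.
Import Order.TTheory GRing.Theory Num.Theory.
Import numFieldNormedType.Exports.

Local Open Scope classical_set_scope.
Local Open Scope ring_scope.

(* "Algebraically independent" here means linearly independent over Q:
   no nontrivial integer relation between finitely many distinct elements. *)
Definition algebraically_independent (R : realType) (L : set R) : Prop :=
  forall (N : nat) (alpha : 'I_N -> R) (k : 'I_N -> int),
    injective alpha -> (forall i, L (alpha i)) ->
    \sum_(i < N) (k i)%:~R * alpha i = 0 -> forall i, k i = 0.

Definition admissible (R : realType) (L : set R) : Prop :=
  [/\ countable L, infinite_set L, ~ bounded_set L, has_lbound L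
    & limit_point L = set0].

(* R with the sigma-algebra of Lebesgue measurable sets (the domain of
   completed_lebesgue_measure); the default one on R is the Borel one. *)
Definition lebesgueTypeR (R : realType) :=
  caratheodory_type ((@wlength R idfun)^*)%mu.

Definition lebesgue_measurable_fun (R : realType) (f : R -> R) : Prop :=
  measurable_fun [set: lebesgueTypeR R]
    (f : lebesgueTypeR R -> measurableTypeR R).

Definition translate_sum (R : realType) (f : R -> R) (L : set R) (x : R) :
    \bar R :=
  \esum_(l in L) (f (x + l))%:E.

Definition convergence_set (R : realType) (f : R -> R) (L : set R) : set R :=
  [set x | (translate_sum f L x < +oo)%E].

Definition divergence_set (R : realType) (f : R -> R) (L : set R) : set R :=
  [set x | translate_sum f L x = +oo%E].

Definition type1 (R : realType) (L : set R) : Prop :=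
  forall f : R -> R, lebesgue_measurable_fun f -> (forall x, 0 <= f x) ->
    completed_lebesgue_measure (divergence_set f L) = 0%E \/
    completed_lebesgue_measure (convergence_set f L) = 0%E.

Definition type2 (R : realType) (L : set R) : Prop := ~ type1 L.

(* Main.v *)
Require Import Defs.
From HB Require Import structures.
From mathcomp Require Import all_boot all_order all_algebra.
From mathcomp Require Import finmap.
From mathcomp Require Import all_classical all_reals all_analysis.
From mathcomp Require Import ring lra.
Import Order.TTheory GRing.Theory Num.Theory.
Import numFieldNormedType.Exports.

Set Implicit Arguments.
Unset Strict Implicit.
Unset Printing Implicit Defensive.

Local Open Scope classical_set_scope.
Local Open Scope ring_scope.

(** Only finitely many elements of Lambda' lie below n; let V_n be the rational
    span of these elements. Its dimension is at least #(Lambda /\ [0, n)), since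
    Lambda is independent. Were the jumps dim V_(n+1) - dim V_n bounded, the
    dimension would grow at most linearly and the limsup could not be infinite.
    So for every K, arbitrarily far out, there is an n such that Lambda' has K
    elements e_0, ..., e_(K-1) in [n, n+1) that are rationally independent modulo
    V_n ([admissible_free_block], which rests on the Steinitz-type bound
    [qspan_dependent]).

    Independence modulo V_n is what Kronecker's theorem asks for to prescribe
    phases: there is t >= 1 such that t f is close to an integer for every
    element f of Lambda' below n, while t e_i is close to - i / K modulo 1
    ([free_over_phases], from [simultaneous_phases]). Let U be the set of those
    x in [n, n+2) for which t x is within 2 / K of an integer.
    - If x is in [0, 1], the residues t x + t e_i modulo 1 are spread so evenly
      that one of the points x + e_i, which all lie in [n, n+2), is in U.
    - If x is in [2, 3] and x + l is in U with l in Lambda', then l < n, so t l is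
      almost an integer, and therefore t x is within 3 / K of an integer. The set
      of such x has measure O(1 / K) ([near_int_measure_le]).
    The left end of the window [n, n+2) is thus what separates the two ranges of x:
    points on the right only see the old elements of Lambda', points on the left
    also see the new ones.

    Take such a block for K = 2^(k+6) and n >= k, for each k, and let f be the
    indicator of the union of the blocks. The sum diverges everywhere on [0, 1].
    On [2, 3] it vanishes outside a union of exceptional sets whose measures add
    up to less than 1, so it converges on a set of positive measure. *)

(** * Mean values of functions of a real variable *)

(** [m] is the limit of the averages of [g] over long intervals, with the rate that
    trigonometric polynomials enjoy. Asking for a primitive at bounded distance from
    a linear function makes linearity immediate and replaces integrals by the mean
    value theorem. *)
Definition has_mean {R : realType} (g : R -> R) (m : R) : Prop :=
  exists G : R -> R, (forall t : R, is_derive t 1 G (g t)) /\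
    exists B, forall t, `|G t - m * t| <= B.

Lemma has_meanD {R : realType} (g h : R -> R) (m n : R) :
  has_mean g m -> has_mean h n -> has_mean (fun t => g t + h t) (m + n).
Proof.
move=> [G [dG [B GB]]] [H [dH [C HC]]]; exists (G + H); split.
  by move=> t; exact: is_deriveD.
exists (B + C) => t.
rewrite [(G + H) t]/(G t + H t) mulrDl opprD addrACA.
by rewrite (le_trans (ler_normD _ _))// lerD.
Qed.

Lemma has_meanZ {R : realType} (g : R -> R) (a m : R) :
  has_mean g m -> has_mean (fun t => a * g t) (a * m).
Proof.
move=> [G [dG [B GB]]]; exists (a *: G); split.
  by move=> t; exact: is_deriveZ.
exists (`|a| * B) => t.
rewrite [(a *: G) t]/(a * G t) -mulrA -mulrBr normrM.
by rewrite ler_wpM2l.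
Qed.

Lemma has_mean_cst {R : realType} (a : R) : has_mean (fun=> a) a.
Proof.
exists (fun t => a * t); split.
  move=> t; rewrite -[X in is_derive _ _ _ X]mulr1.
  exact: (is_deriveZ a).
by exists 0 => t; rewrite subrr normr0.
Qed.

Lemma has_mean_sum {R : realType} (I : Type) (s : seq I) (P : pred I)
    (F : I -> R -> R) (m : I -> R) : (forall i, has_mean (F i) (m i)) ->
  has_mean (fun t => \sum_(i <- s | P i) F i t) (\sum_(i <- s | P i) m i).
Proof.
move=> Fm; elim: s => [|i s IH].
  by under eq_fun do rewrite big_nil; rewrite big_nil; exact: has_mean_cst.
under eq_fun do rewrite big_cons; rewrite big_cons.
by case: (boolP (P i)) => // _; exact: has_meanD.
Qed.

Lemma has_mean_cos {R : realType} (b c : R) :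
  has_mean (fun t => cos (b * t + c)) (if b == 0 then cos c else 0).
Proof.
case: eqVneq => [->|b0].
  rewrite (_ : (fun t => _) = fun=> cos c); first exact: has_mean_cst.
  by apply/funext => t; rewrite mul0r add0r.
exists (fun t => b^-1 * sin (b * t + c)); split.
  move=> t.
  have d1 : is_derive t 1 (fun t : R => b * t + c) b.
    apply: is_derive_eq (is_deriveD (is_deriveZ b (is_derive_id t 1)) (is_derive_cst c t 1)) _.
    by rewrite addr0 /GRing.scale/= mulr1.
  have d2 := @is_derive1_comp R sin (fun t => b * t + c) t _ _ (is_derive_sin _) d1.
  apply: is_derive_eq (is_deriveZ b^-1 d2) _.
  by rewrite /GRing.scale/= mulrCA mulVf// mulr1.
exists `|b^-1| => t; rewrite mul0r subr0 normrM ler_piMr//.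
by rewrite ler_norml sin_geN1 sin_le1.
Qed.

(** Comparing only beyond [T] is enough, because a mean ignores every half-line on
    the left. This is what later yields a large [t]. *)
Lemma has_mean_le {R : realType} (g h : R -> R) (m n T : R) :
  has_mean g m -> has_mean h n -> (forall t, T <= t -> g t <= h t) -> m <= n.
Proof.
move=> hg [H [dH [C HC]]] gh.
have [K [dK [B KB]]] := has_meanD hg (has_meanZ (-1) (ex_intro _ H (conj dH (ex_intro _ C HC)))).
rewrite leNgt; apply/negP => nm.
have d0 : 0 < m - n by rewrite subr_gt0.
have B0 : 0 <= B by apply: le_trans (KB 0).
have mono t : T <= t -> K t <= K T.
  move=> Tt; rewrite -subr_le0.
  have cK : {within `[T, t], continuous K}.
    apply: derivable_within_continuous => x _.
    by have [] := dK x.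
  have [c ct ->] := MVT_segment Tt (fun x _ => dK x) cK.
  rewrite in_itv/= in ct; case/andP: ct => Tc _.
  by rewrite mulr_le0_ge0 ?subr_ge0// mulN1r subr_le0 gh.
(* The primitive K of g - h does not increase beyond T, yet it stays within B of
   a line of slope m - n > 0; at this t the line is too high. *)
pose t := `|T| + (`|K T| + B + 1) / (m - n).
have Tt : T <= t.
  by rewrite (le_trans (ler_norm _))// lerDl divr_ge0// ?(ltW d0)// !addr_ge0.
have := KB t; rewrite ler_norml => /andP[+ _].
have := mono t Tt.
have : (m - n) * t >= `|K T| + B + 1.
  rewrite mulrDr mulrCA divff ?gt_eqF// mulr1 lerDr.
  by rewrite mulr_ge0// ltW.
have := ler_norm (K T).
rewrite mulN1r; lra.
Qed.

(** * Kronecker's theorem on simultaneous approximation *)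

(** The subgroup generated by a list; recursion on the list spares coefficient
    vectors. *)
Fixpoint zspan {V : zmodType} (s : seq V) (v : V) : Prop :=
  if s is p :: s' then exists k : int, zspan s' (v - p *~ k) else v = 0.

Lemma zspan0 {V : zmodType} (s : seq V) : zspan s 0.
Proof. by elim: s => //= p s IH; exists 0; rewrite mulr0z subr0. Qed.

Lemma zspanB {V : zmodType} (s : seq V) (u v : V) :
  zspan s u -> zspan s v -> zspan s (u - v).
Proof.
elim: s u v => [|p s IH] u v /=; first by move=> -> ->; rewrite subr0.
move=> [k uk] [l vl]; exists (k - l).
rewrite mulrzBr (_ : _ - _ = (u - p *~ k) - (v - p *~ l)); first exact: IH.
by rewrite !opprB addrACA [RHS]addrACA [- v - _]addrC.
Qed.

Lemma zspanN {V : zmodType} (s : seq V) (v : V) : zspan s v -> zspan s (- v).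
Proof. by move=> sv; rewrite -sub0r; apply: zspanB => //; exact: zspan0. Qed.

Lemma zspanD {V : zmodType} (s : seq V) (u v : V) :
  zspan s u -> zspan s v -> zspan s (u + v).
Proof. by move=> su sv; rewrite -[v]opprK; apply: zspanB => //; exact: zspanN. Qed.

Lemma mem_zspan {V : zmodType} (s : seq V) (v : V) : v \in s -> zspan s v.
Proof.
elim: s => //= p s IH; rewrite inE => /orP[/eqP ->|/IH sv].
  by exists 1; rewrite mulr1z subrr; exact: zspan0.
by exists 0; rewrite mulr0z subr0.
Qed.

Lemma zspanMz {V : zmodType} (s : seq V) (v : V) (k : int) :
  zspan s v -> zspan s (v *~ k).
Proof.
move=> sv; have svn n : zspan s (v *+ n).
  elim: n => [|n IH]; first by rewrite mulr0n; exact: zspan0.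
  by rewrite mulrS; exact: zspanD.
by case: k => n; rewrite ?NegzE ?mulrNz -pmulrn//; exact: zspanN.
Qed.

(** Trigonometric polynomials with nonnegative coefficients whose frequencies and
    phases come from one subgroup of the plane. This cone is closed under products,
    and if all relations between the frequencies in [L] are respected by the phases,
    its elements have nonnegative mean: a term of frequency [0] is then a
    nonnegative constant. *)
Inductive positive_cosines {R : realType} (L : seq (R * R)) : (R -> R) -> Prop :=
| positive_cosines0 : positive_cosines L (fun=> 0)
| positive_cosines_cons g a b c : 0 <= a -> zspan L (b, c) ->
    positive_cosines L g -> positive_cosines L (fun t => a * cos (b * t + c) + g t).

Section PositiveCosines.
Context {R : realType}.
Implicit Types (L : seq (R * R)) (g h : R -> R).

Lemma positive_cosines_cos L a b c : 0 <= a -> zspan L (b, c) ->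
  positive_cosines L (fun t => a * cos (b * t + c)).
Proof.
move=> a0 Lbc; have := positive_cosines_cons a0 Lbc (positive_cosines0 L).
by under eq_fun do rewrite addr0.
Qed.

Lemma positive_cosinesD L g h : positive_cosines L g -> positive_cosines L h ->
  positive_cosines L (fun t => g t + h t).
Proof.
move=> Lg Lh; elim: Lg => [|{}g a b c a0 Lbc _ IH].
  by under eq_fun do rewrite add0r.
by under eq_fun do rewrite -addrA; exact: positive_cosines_cons.
Qed.

Lemma positive_cosines_mulcos L g a b c : 0 <= a -> zspan L (b, c) ->
  positive_cosines L g -> positive_cosines L (fun t => a * cos (b * t + c) * g t).
Proof.
move=> a0 Lbc; elim=> [|{}g a' b' c' a'0 Lbc' _ IH].
  by under eq_fun do rewrite mulr0; exact: positive_cosines0.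
pose A := a * a' / 2.
have A0 : 0 <= A by rewrite divr_ge0// mulr_ge0.
rewrite (_ : (fun t => _) = fun t =>
  (A * cos ((b + b') * t + (c + c')) + A * cos ((b - b') * t + (c - c')))
  + a * cos (b * t + c) * g t).
  apply: positive_cosinesD IH; apply: positive_cosinesD.
    exact: (positive_cosines_cos A0 (zspanD Lbc Lbc')).
  exact: (positive_cosines_cos A0 (zspanB Lbc Lbc')).
apply/funext => t; rewrite mulrDr; congr (_ + _).
rewrite (_ : (b + b') * t + _ = (b * t + c) + (b' * t + c')); last by ring.
rewrite (_ : (b - b') * t + _ = (b * t + c) - (b' * t + c')); last by ring.
by move: (b * t + c) (b' * t + c') => x y; rewrite cosD cosB /A; field.
Qed.

Lemma positive_cosinesM L g h : positive_cosines L g -> positive_cosines L h ->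
  positive_cosines L (fun t => g t * h t).
Proof.
move=> Lg Lh; elim: Lg => [|{}g a b c a0 Lbc _ IH].
  by under eq_fun do rewrite mul0r; exact: positive_cosines0.
under eq_fun do rewrite mulrDl.
by apply: positive_cosinesD IH; exact: positive_cosines_mulcos.
Qed.

Lemma positive_cosines_sum L (I : Type) (s : seq I) (P : pred I) (F : I -> R -> R) :
  (forall i, P i -> positive_cosines L (F i)) ->
  positive_cosines L (fun t => \sum_(i <- s | P i) F i t).
Proof.
move=> LF; elim: s => [|i s IH].
  by under eq_fun do rewrite big_nil; exact: positive_cosines0.
under eq_fun do rewrite big_cons.
by case: (boolP (P i)) => // Pi; apply: positive_cosinesD => //; exact: LF.
Qed.

(** Hence discarding factors of the form 1 + (positive cosines) from a product can
    only lower the mean. *)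
Lemma positive_cosines_prod_sub1 L (I : Type) (s : seq I) (P : pred I) (F : I -> R -> R) :
  (forall i, positive_cosines L (fun t => F i t - 1)) ->
  positive_cosines L (fun t => \prod_(i <- s | P i) F i t - 1).
Proof.
move=> LF; elim: s => [|i s IH].
  by under eq_fun do rewrite big_nil subrr; exact: positive_cosines0.
under eq_fun do rewrite big_cons.
case: (boolP (P i)) => // _.
rewrite (_ : (fun t => _) = fun t =>
  ((F i t - 1) * (\prod_(j <- s | P j) F j t - 1) + (F i t - 1))
  + (\prod_(j <- s | P j) F j t - 1)); last by apply/funext => t; ring.
exact: (positive_cosinesD (positive_cosinesD (positive_cosinesM (LF i) IH) (LF i)) IH).
Qed.

Lemma positive_cosines_mean L g : (forall c, zspan L (0, c) -> cos c = 1) ->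
  positive_cosines L g -> exists2 m, 0 <= m & has_mean g m.
Proof.
move=> L1; elim=> [|{}g a b c a0 Lbc _ [m m0 gm]].
  by exists 0 => //; exact: has_mean_cst.
exists (a * (if b == 0 then cos c else 0) + m); last first.
  exact: has_meanD (has_meanZ _ (has_mean_cos _ _)) gm.
rewrite addr_ge0// mulr_ge0//; case: eqVneq => // b0.
by rewrite b0 in Lbc; rewrite L1.
Qed.

End PositiveCosines.

(** The Fejér kernel, up to normalization the square modulus of a geometric sum of
    the exponentials exp(i j u). *)
Definition fejer {R : realType} (N : nat) (u : R) : R :=
  N%:R^-1 * ((\sum_(j < N) cos (j%:R * u)) ^+ 2 + (\sum_(j < N) sin (j%:R * u)) ^+ 2).

Section Fejer.
Context {R : realType}.
Implicit Types (N : nat) (u : R).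

Lemma fejer_ge0 N u : 0 <= fejer N u.
Proof. by rewrite mulr_ge0 ?invr_ge0// addr_ge0// sqr_ge0. Qed.

Lemma fejerE N u : fejer N u =
  \sum_(j < N) \sum_(l < N) N%:R^-1 * cos ((j%:R - l%:R) * u).
Proof.
rewrite /fejer mulrDr !expr2 !big_distrlr !big_distrr/= -big_split/=.
apply: eq_bigr => j _; rewrite !big_distrr -big_split/=; apply: eq_bigr => l _.
by rewrite mulrBl cosB mulrDr.
Qed.

(** Real and imaginary parts of the telescoping of (1 - exp(i u)) against the sum of
    the exp(i j u). *)
Lemma geometric_cos_sin N u :
  (\sum_(j < N) cos (j%:R * u)) * (1 - cos u) + (\sum_(j < N) sin (j%:R * u)) * sin u
    = 1 - cos (N%:R * u) /\
  (\sum_(j < N) sin (j%:R * u)) * (1 - cos u) - (\sum_(j < N) cos (j%:R * u)) * sin u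
    = - sin (N%:R * u).
Proof.
elim: N => [|N [IH1 IH2]].
  by rewrite !big_ord0 !mul0r cos0 sin0; split; ring.
rewrite !big_ord_recr/= -natr1 [(N%:R + 1) * u]mulrDl mul1r cosD sinD.
move: IH1 IH2; set C := \sum_(_ < _) _; set S := \sum_(_ < _) _.
by move=> IH1 IH2; split; lra.
Qed.

(** Taking square moduli in the telescoped sum gives
    (C^2 + S^2) * 2 (1 - cos u) = 2 (1 - cos (N u)), which is at most 4. *)
Lemma fejer_le N u (d : R) : (0 < N)%N -> 0 < d -> d <= 1 - cos u ->
  fejer N u <= 2 / (N%:R * d).
Proof.
move=> N0 d0 du; have [] := geometric_cos_sin N u; rewrite /fejer.
set C := \sum_(_ < _) _; set S := \sum_(_ < _) _ => e1 e2.
have NR : 0 < N%:R :> R by rewrite ltr0n.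
rewrite ler_pdivlMr ?mulr_gt0// mulrACA mulVf ?gt_eqF// mul1r.
have n1 : cos u ^+ 2 + sin u ^+ 2 = 1 by rewrite cos2Dsin2.
have n2 : cos (N%:R * u) ^+ 2 + sin (N%:R * u) ^+ 2 = 1 by rewrite cos2Dsin2.
have key : (C ^+ 2 + S ^+ 2) * (2 * (1 - cos u)) = 2 * (1 - cos (N%:R * u)).
  have : (C * (1 - cos u) + S * sin u) ^+ 2 + (S * (1 - cos u) - C * sin u) ^+ 2 =
    (1 - cos (N%:R * u)) ^+ 2 + (- sin (N%:R * u)) ^+ 2 by rewrite e1 e2.
  rewrite (_ : (1 - cos (N%:R * u)) ^+ 2 + (- sin (N%:R * u)) ^+ 2 =
    1 - 2 * cos (N%:R * u) + (cos (N%:R * u) ^+ 2 + sin (N%:R * u) ^+ 2)); last by ring.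
  rewrite (_ : (C * (1 - cos u) + S * sin u) ^+ 2 + (S * (1 - cos u) - C * sin u) ^+ 2 =
    (C ^+ 2 + S ^+ 2) * (1 - 2 * cos u + (cos u ^+ 2 + sin u ^+ 2))); last by ring.
  by rewrite n1 n2 => h; rewrite (_ : 2 * _ = 1 - 2 * cos u + 1) ?h; ring.
have CS0 : 0 <= C ^+ 2 + S ^+ 2 by rewrite addr_ge0// sqr_ge0.
have := ler_wpM2l CS0 du.
have := cos_geN1 (N%:R * u); lra.
Qed.

Lemma fejer_sub1_positive_cosines (L : seq (R * R)) (p : R * R) N : (0 < N)%N ->
  p \in L -> positive_cosines L (fun t => fejer N (p.1 * t + p.2) - 1).
Proof.
move=> N0 pL.
rewrite (_ : (fun t => _) = fun t => \sum_(j < N) \sum_(l < N | l != j)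
   N%:R^-1 * cos ((p.1 *~ (j%:Z - l%:Z)) * t + p.2 *~ (j%:Z - l%:Z))).
  apply: positive_cosines_sum => j _; apply: positive_cosines_sum => l _.
  apply: positive_cosines_cos; first by rewrite invr_ge0.
  have : zspan L (p *~ (j%:Z - l%:Z)).
    by apply: zspanMz; exact: mem_zspan.
  suff -> : p *~ (j%:Z - l%:Z) = (p.1 *~ (j%:Z - l%:Z), p.2 *~ (j%:Z - l%:Z)) by [].
  by rewrite [LHS]surjective_pairing !raddfMz.
apply/funext => t; rewrite fejerE.
rewrite [X in _ - X](_ : 1 = \sum_(j < N) N%:R^-1); last first.
  by rewrite sumr_const card_ord -[RHS]mulr_natl divff// pnatr_eq0 -lt0n.
rewrite -sumrB; apply: eq_bigr => j _.
rewrite (bigD1 j)//= subrr mul0r cos0 mulr1 [LHS]addrAC subrr add0r.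
apply: eq_bigr => l _; congr (_ * cos _).
rewrite -[p.1 *~ _]mulrzl -[p.2 *~ _]mulrzl rmorphB/=.
by rewrite mulrDr !mulrA.
Qed.

End Fejer.

(** Kronecker's theorem: real phases that respect every integer relation between
    the frequencies can be approached simultaneously, at arbitrarily large times.

    Let P be the product of the Fejér kernels of the phases, and Q_i the same
    product without the [i]-th factor. If at every time some phase were off by more
    than [eps], P would be bounded by the sum of the eta Q_i, where eta bounds the
    kernel away from its peak. But the mean of each Q_i is at most that of P, which
    is positive, and eta times the number of phases is less than 1 when N is
    large. *)
Lemma simultaneous_phases {R : realType} (L : seq (R * R)) (eps T : R) :
  (forall c, zspan L (0, c) -> cos c = 1) -> 0 < eps ->
  exists2 t, T <= t & forall p, p \in L -> 1 - cos (p.1 * t + p.2) < eps.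
Proof.
move=> L1 eps0; apply: contrapT => noT.
have bad t : T <= t -> exists i : 'I_(size L),
    eps <= 1 - cos ((tnth (in_tuple L) i).1 * t + (tnth (in_tuple L) i).2).
  move=> Tt; apply: contrapT => all_good; apply: noT; exists t => // p pL.
  rewrite ltNge; apply/negP => ple; apply: all_good.
  by have /tnthP[i pi] : p \in in_tuple L by []; exists i; rewrite -pi.
set r := size L in bad *.
pose N := (Num.truncn (2 * r%:R / eps)).+1.
have N0 : (0 < N)%N by [].
have NR : 0 < N%:R :> R by rewrite ltr0n.
pose eta : R := 2 / (N%:R * eps).
have eta0 : 0 < eta by rewrite divr_gt0// mulr_gt0.
have eta1 : eta * r%:R < 1.
  rewrite /eta mulrAC ltr_pdivrMr ?mulr_gt0// mul1r -ltr_pdivrMr//.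
  by rewrite truncnS_gt.
pose K (i : 'I_r) (t : R) := fejer N ((tnth (in_tuple L) i).1 * t + (tnth (in_tuple L) i).2).
have K0 i t : 0 <= K i t by exact: fejer_ge0.
have K1 i : positive_cosines L (fun t => K i t - 1).
  by apply: fejer_sub1_positive_cosines => //; exact: mem_tnth.
pose P t := \prod_(i < r) K i t.
pose Q (i : 'I_r) t := \prod_(j < r | j != i) K j t.
have PE i t : P t = K i t * Q i t by rewrite /P (bigD1 i).
have [m' m'0 hm'] := positive_cosines_mean L1 (positive_cosines_prod_sub1 (index_enum _) xpredT K1).
pose m := 1 + m'.
have hm : has_mean P m.
  have := has_meanD (has_mean_cst 1) hm'.
  by under eq_fun do rewrite addrC subrK.
have Qmean i : exists2 q, q <= m & has_mean (Q i) q.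
  have Q1 := positive_cosines_prod_sub1 (index_enum _) (fun j => j != i) K1.
  have [q' q'0 hq'] := positive_cosines_mean L1 Q1.
  have hq : has_mean (Q i) (1 + q').
    have := has_meanD (has_mean_cst 1) hq'.
    by under eq_fun do rewrite addrC subrK.
  exists (1 + q') => //.
  have [d d0 hd] := positive_cosines_mean L1 (positive_cosinesD (positive_cosinesM (K1 i) Q1) (K1 i)).
  have := has_meanD hq hd.
  rewrite (_ : (fun t => _) = P); last first.
    by apply/funext => t; rewrite (PE i) /Q; ring.
  move=> h; have := has_mean_le (T := 0) h hm (fun t _ => lexx _).
  by apply: le_trans; rewrite lerDl.
have [q qm hq] : exists2 q : 'I_r -> R, forall i, q i <= m & forall i, has_mean (Q i) (q i).
  have /choice[q hq] : forall i, exists q, q <= m /\ has_mean (Q i) q.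
    by move=> i; have [q] := Qmean i; exists q.
  by exists q => i; have [] := hq i.
have hS := has_mean_sum (index_enum _) xpredT (fun i => has_meanZ eta (hq i)).
have mS : m <= \sum_(i < r) eta * q i.
  apply: (has_mean_le (T := T) hm hS) => t Tt.
  have [i ei] := bad t Tt.
  have Q0 j : 0 <= Q j t by apply: prodr_ge0 => l _; exact: K0.
  rewrite (bigD1 i)//= (PE i) ler_wpDr//.
    by apply: sumr_ge0 => j _; rewrite mulr_ge0 ?(ltW eta0).
  by rewrite ler_wpM2r//; exact: fejer_le.
suff : \sum_(i < r) eta * q i < m by rewrite ltNge mS.
have m0 : 0 < m by rewrite ltr_pwDl.
apply: (@le_lt_trans _ _ (\sum_(i < r) eta * m)).
  by apply: ler_sum => i _; rewrite ler_wpM2l// ltW.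
by rewrite sumr_const card_ord -mulr_natr mulrAC gtr_pMl.
Qed.

(** * Rational spans and independence modulo a span *)

Fixpoint qspan {R : realType} (s : seq R) (x : R) : Prop :=
  if s is a :: s' then exists q : rat, qspan s' (x - ratr q * a) else x = 0.

Section RationalSpan.
Context {R : realType}.
Implicit Types (s F B C : seq R) (x y : R).

Lemma qspan0 s : qspan s 0.
Proof. by elim: s => //= a s IH; exists 0; rewrite raddf0 mul0r subr0. Qed.

Lemma qspanD s x y : qspan s x -> qspan s y -> qspan s (x + y).
Proof.
elim: s x y => [|a s IH] x y /=; first by move=> -> ->; rewrite addr0.
move=> [p xp] [q yq]; exists (p + q).
by rewrite rmorphD/= mulrDl opprD addrACA; exact: IH.
Qed.

Lemma qspanZ s (q : rat) x : qspan s x -> qspan s (ratr q * x).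
Proof.
elim: s x => [|a s IH] x /=; first by move=> ->; rewrite mulr0.
move=> [p xp]; exists (q * p).
by rewrite rmorphM/= -(mulrA (ratr q) (ratr p)) -mulrBr; exact: IH.
Qed.

Lemma qspan_cons a s x : qspan s x -> qspan (a :: s) x.
Proof. by move=> sx; exists 0; rewrite raddf0 mul0r subr0. Qed.

Lemma mem_qspan s x : x \in s -> qspan s x.
Proof.
elim: s => //= a s IH; rewrite inE => /orP[/eqP ->|/IH].
  by exists 1; rewrite rmorph1 mul1r subrr; exact: qspan0.
exact: (@qspan_cons a).
Qed.

Lemma qspan_trans s1 s2 x : (forall y, y \in s1 -> qspan s2 y) ->
  qspan s1 x -> qspan s2 x.
Proof.
elim: s1 x => [|a s1 IH] x /= s12; first by move=> ->; exact: qspan0.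
move=> [q xq]; rewrite -[x](subrK (ratr q * a)).
apply: qspanD; last by apply: qspanZ; apply: s12; rewrite mem_head.
by apply: IH => // y ys; apply: s12; rewrite in_cons ys orbT.
Qed.

Lemma qspan_coef s x : qspan s x ->
  exists v : 'I_(size s) -> rat, x = \sum_i ratr (v i) * s`_i.
Proof.
elim: s x => [|a s IH] x /=; first by move=> ->; exists (fun=> 0); rewrite big_ord0.
move=> [q /IH[v xv]].
exists (fun i => if unlift ord0 i is Some j then v j else q).
rewrite big_ord_recl unlift_none/= -[LHS](subrK (ratr q * a)) xv addrC.
by congr (_ + _); apply: eq_bigr => i _; rewrite liftK.
Qed.

(** More vectors than generators are linearly dependent: a nonzero left kernel vector
    of the matrix of rational coordinates, cleared of its denominators. *)
Lemma qspan_dependent s C : (forall c, c \in C -> qspan s c) ->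
  (size s < size C)%N ->
  exists k : 'I_(size C) -> int,
    (exists i, k i != 0) /\ \sum_i (k i)%:~R * C`_i = 0.
Proof.
move=> sC ltsC.
have /choice[v Cv] : forall i : 'I_(size C), exists v : 'I_(size s) -> rat,
    C`_i = \sum_j ratr (v j) * s`_j.
  by move=> i; apply: qspan_coef; apply: sC; exact: mem_nth.
pose A := \matrix_(i < size C, j < size s) v i j.
have kerA0 : kermx A != 0.
  rewrite kermx_eq0 /row_free; apply: contraTneq ltsC => <-.
  by rewrite -leqNgt rank_leq_col.
have /rowV0Pn[w wker w0] := kerA0.
have wA : w *m A = 0 by apply/sub_kermxP.
have [i wi0] : exists i, w 0 i != 0.
  apply: contrapT => /forallNP all0; move/eqP: w0; apply; apply/rowP => i.
  by rewrite mxE; apply/eqP; apply: contrapT => /negP; exact: all0.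
have relw : \sum_i ratr (w 0 i) * C`_i = 0.
  under eq_bigr do rewrite Cv big_distrr/=.
  rewrite exchange_big/= big1// => j _.
  under eq_bigr do rewrite mulrA -rmorphM/=.
  rewrite -mulr_suml -rmorph_sum/=.
  have := congr1 (fun M : 'rV_(size s) => M 0 j) wA; rewrite !mxE => wAj.
  rewrite (_ : \sum_i _ = 0) ?raddf0 ?mul0r// -[RHS]wAj.
  by apply: eq_bigr => l _; rewrite mxE.
pose D (i : 'I_(size C)) : int := \prod_(j < size C | j != i) denq (w 0 j).
(* D i is the product of the denominators other than the i-th one, so this is w
   multiplied by the common denominator d. *)
exists (fun i => numq (w 0 i) * D i); split.
  exists i; rewrite mulf_neq0 ?numq_eq0//.
  by apply/prodf_neq0 => j _; rewrite denq_eq0.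
pose d : int := \prod_(j < size C) denq (w 0 j).
transitivity (d%:~R * \sum_i ratr (w 0 i) * C`_i); last by rewrite relw mulr0.
rewrite big_distrr/=; apply: eq_bigr => j _; rewrite mulrA; congr (_ * _).
rewrite /d (bigD1 j)//= -/(D j) !intrM mulrAC; congr (_ * _).
by rewrite /ratr mulrC divfK// intr_eq0 denq_eq0.
Qed.

Lemma qspan_of_multiple s x (k : int) : k != 0 -> qspan s (- (x *~ k)) -> qspan s x.
Proof.
move=> k0 /(@qspanZ _ (- (k%:~R)^-1)); congr qspan.
rewrite rmorphN fmorphV/= ratr_int mulrNN -[x *~ k]mulrzr mulrCA mulVf ?mulr1//.
by rewrite intr_eq0.
Qed.

End RationalSpan.

(** Linear independence over the rationals modulo the span of [F]. *)
Fixpoint free_over {R : realType} (F B : seq R) : Prop :=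
  if B is b :: B' then ~ qspan (B' ++ F) b /\ free_over F B' else True.

Section FreeOver.
Context {R : realType}.
Implicit Types (F B G : seq R).

Lemma free_over_drop F B n : free_over F B -> free_over F (drop n B).
Proof.
by elim: B n => [|b B IH] [|n] //= [bF BF]; exact: IH.
Qed.

(** The basis is extracted greedily: an element is kept exactly when it is not yet in
    the span. *)
Lemma free_over_spanning F G : exists B,
  [/\ {subset B <= G}, free_over F B & forall g, g \in G -> qspan (B ++ F) g].
Proof.
elim: G => [|g G [B [BG Bfree GB]]]; first by exists [::].
have [gB|gB] := pselect (qspan (B ++ F) g).
  exists B; split => // [b /BG bG|h]; first by rewrite in_cons bG orbT.
  by rewrite in_cons => /orP[/eqP ->//|]; exact: GB.
exists (g :: B); split => // [b|h].
  by rewrite !in_cons => /orP[->//|/BG ->]; rewrite orbT.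
rewrite in_cons => /orP[/eqP ->|/GB]; last exact: (@qspan_cons _ g).
by apply: mem_qspan; rewrite mem_head.
Qed.

Lemma subMz_pair (p q : R * R) (k : int) :
  p - q *~ k = (p.1 - q.1 *~ k, p.2 - q.2 *~ k).
Proof. by rewrite [LHS]surjective_pairing !raddfB !raddfMz. Qed.

Lemma zspan_qspan (L : seq (R * R)) v : zspan L v -> qspan [seq p.1 | p <- L] v.1.
Proof.
elim: L v => [|p L IH] v /=; first by move=> ->.
move=> [k /IH]; rewrite subMz_pair/= => h; exists k%:~R.
by rewrite ratr_int mulrC mulrzr.
Qed.

(** Relations between the [B] and [F] do not involve the [B], so phases that vanish on
    [F] and are arbitrary on [B] respect all of them, as Kronecker's theorem
    requires. *)
Lemma free_over_zspan F (L : seq (R * R)) c : free_over F [seq p.1 | p <- L] ->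
  zspan (L ++ [seq (f, 0) | f <- F]) (0, c) -> c = 0.
Proof.
elim: L c => [|p L IH] c /=.
  move=> _; move: (0 in X in zspan _ X -> _) => x.
  elim: F x => [|f F IH] x /=; first by case.
  by move=> [k]; rewrite subMz_pair/= mul0rz subr0 => /IH.
move=> [pF LF] [k].
rewrite subMz_pair/= sub0r => h.
have [k0|k0] := eqVneq k 0.
  by move: h; rewrite k0 !mulr0z oppr0 addr0; exact: IH.
have := zspan_qspan h; rewrite map_cat -map_comp map_id/=.
by move=> /(qspan_of_multiple k0).
Qed.

End FreeOver.

(** * Large jumps of the rank of an admissible set *)

Lemma admissible_finite_initial {R : realType} (L : set R) (y : R) :
  admissible L -> finite_set [set x | L x /\ x < y].
Proof.
move=> [_ _ _ [a aL] nolim]; apply: contrapT => infA.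
have bA : bounded_set [set x | L x /\ x < y].
  exists (`|a| + `|y|); split => [|N hN x /= [Lx xy]]; first exact: num_real.
  apply: le_trans (ltW hN).
  rewrite ler_norml; have := aL _ Lx.
  have := ler_norm y; have := ler_norm (- a); rewrite normrN.
  have := normr_ge0 a; have := normr_ge0 y; lra.
have [p pA] := infinite_bounded_limit_point_nonempty infA bA.
suff : limit_point L p by rewrite nolim.
by move=> U /pA [z [zp [Lz _] Uz]]; exists z.
Qed.

Lemma limn_esup_pinfty_unbounded {R : realType} (u : (\bar R)^nat) (M : R) (n0 : nat) :
  limn_esup u = +oo%E -> exists2 n, (n0 <= n)%N & (M%:E < u n)%E.
Proof.
move=> uoo; apply: contrapT => ubM.
suff : (limn_esup u <= M%:E)%E by rewrite uoo leye_eq.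
rewrite /limn_esup limf_esupE.
apply: (@le_trans _ _ (ereal_sup (u @` [set n | (n0 <= n)%N]))).
  apply: ereal_inf_lbound; exists [set n | (n0 <= n)%N] => //.
  by exists n0.
apply: ge_ereal_sup => _ [n /= n0n <-].
by rewrite leNgt; apply/negP => Mu; apply: ubM; exists n.
Qed.

Lemma algebraically_independent_count {R : realType} (L A : set R) (s : seq R) :
  algebraically_independent L -> A `<=` L -> (forall x, A x -> qspan s x) ->
  (counting A <= (size s)%:R%:E :> \bar R)%E.
Proof.
move=> indL AL As.
have bound C : uniq C -> (forall c, c \in C -> A c) -> (size C <= size s)%N.
  move=> uC CA; rewrite leqNgt; apply/negP => ltsC.
  have [k [[i ki0] k0]] := qspan_dependent (fun c cC => As _ (CA c cC)) ltsC.
  move/eqP: ki0; apply; apply: (indL _ (fun i : 'I_(size C) => C`_i) k _ _ k0).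
    move=> x y /eqP; rewrite nth_uniq// => /eqP; exact: val_inj.
  by move=> j; apply/AL/CA; exact: mem_nth.
rewrite /counting; case: asboolP => [finA|infA].
  rewrite lee_fin ler_nat; apply: bound => [|c]; first exact: fset_uniq.
  by rewrite in_fset_set// inE.
have [B BA cB] := infinite_set_fset (size s).+1 infA.
suff : ((size s).+1 <= size s)%N by rewrite ltnn.
apply: leq_trans cB _; apply: bound => [|c cB]; first exact: fset_uniq.
exact: BA.
Qed.

(** If from [n0] on each interval [n, n+1) contributed at most [K] new dimensions, the
    part of [M] below [n] would lie in the span of a list of length
    c + K (n - n0), and the independent set [L] would have at most (c + K) n
    elements in [0, n). *)
Lemma admissible_free_block {R : realType} (L M : set R) (K n0 : nat) :
  algebraically_independent L -> admissible M -> L `<=` M ->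
  limn_esup (fun n : nat =>
    (counting (L `&` `[0%R, (n%:R : R)%R[) / (n%:R)%:E)%E : \bar R) = +oo%E ->
  exists n F B, [/\ (n0 <= n)%N, forall x, M x -> x < n%:R -> x \in F,
    forall b, b \in B -> M b /\ n%:R <= b < n%:R + 1, size B = K & free_over F B].
Proof.
move=> indL admM LM limsup; apply: contrapT => nojump.
have /choice[F hF] : forall n : nat, exists F : seq R, forall x, x \in F <-> M x /\ x < n%:R.
  move=> n; have /finite_seqP[F hF] := admissible_finite_initial n%:R admM.
  by exists F => x; have /= := congr1 (fun A : set R => A x) hF; move=> <-.
have step n : (n0 <= n)%N -> exists2 B, (size B <= K)%N &
    forall x, x \in F n.+1 -> qspan (B ++ F n) x.
  move=> n0n.
  have [B [BG Bfree GB]] := free_over_spanning (F n) [seq x <- F n.+1 | n%:R <= x].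
  exists B; last first.
    move=> x xF; have [xn|nx] := ltP x n%:R.
      apply: mem_qspan; rewrite mem_cat; apply/orP; right; apply/hF; split => //.
      by move/hF : xF => [].
    by apply: GB; rewrite mem_filter nx.
  rewrite leqNgt; apply/negP => KB; apply: nojump.
  exists n, (F n), (drop (size B - K) B); split => //.
  - by move=> x Mx xn; apply/hF.
  - move=> b /mem_drop /BG; rewrite mem_filter => /andP[-> /hF[Mb]].
    by rewrite -natr1 => ->.
  - by rewrite size_drop subKn// ltnW.
  - exact: free_over_drop.
have rank j : exists2 s, (size s <= size (F n0) + K * j)%N &
    forall x, x \in F (n0 + j)%N -> qspan s x.
  elim: j => [|j [s sle sF]].
    by exists (F n0); rewrite ?muln0 ?addn0//; exact: mem_qspan.
  have [B BK BF] := step (n0 + j)%N (leq_addr _ _).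
  exists (B ++ s).
    by rewrite size_cat mulnS addnCA leq_add.
  move=> x; rewrite addnS => /BF; apply: qspan_trans => y.
  rewrite mem_cat => /orP[yB|/sF sy]; first by apply: mem_qspan; rewrite mem_cat yB.
  by elim: {BK BF} B => //= b B IH; exact: qspan_cons.
have [n n0n] := limn_esup_pinfty_unbounded (size (F n0) + K)%:R n0.+1 limsup.
have n_gt0 : (0 < n)%N by exact: leq_trans n0n.
have [s sle sF] := rank (n - n0)%N.
rewrite subnKC ?(ltnW n0n)// in sF.
rewrite inver gt_eqF ?ltr0n// lte_pdivlMr ?ltr0n//; apply/negP; rewrite -leNgt.
apply: (@le_trans _ _ (size s)%:R%:E).
  apply: (algebraically_independent_count indL) => [x []//|x [Lx]] /=.
  rewrite in_itv/= => /andP[_ xn]; apply: sF; apply/hF; split => //; exact: LM.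
rewrite -EFinM lee_fin -natrM ler_nat (leq_trans sle)// mulnDl leq_add//.
  by rewrite leq_pmulr.
by rewrite leq_mul// leq_subr.
Qed.

(** * Blocks of oscillating windows *)

Definition near_int {R : realType} (u rho : R) : Prop :=
  exists m : int, `|u - m%:~R| <= rho.

Section NearInt.
Context {R : realType}.
Implicit Types (u v rho : R).

Lemma near_intD u v a b : near_int u a -> near_int v b -> near_int (u + v) (a + b).
Proof.
move=> [m um] [n vn]; exists (m + n).
by rewrite rmorphD/= opprD addrACA (le_trans (ler_normD _ _))// lerD.
Qed.

Lemma near_intN u a : near_int u a -> near_int (- u) a.
Proof. by move=> [m um]; exists (- m); rewrite rmorphN/= -opprD normrN. Qed.

Lemma cosD2pi_int (k : int) u : cos (u + 2 * pi * k%:~R) = cos u.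
Proof.
have nat_case n v : cos (v + 2 * pi * n%:R) = cos v.
  by rewrite mulr_natr mulr_natl (periodicn (@cosD2pi R)).
case: k => n; first exact: nat_case.
by rewrite NegzE rmorphN/= mulrN -[in RHS](subrK (2 * pi * n.+1%:R) u) nat_case.
Qed.

Lemma half_turn_itv u : 0 <= u -> u <= 2^-1 -> 2 * pi * u \in `[0, pi].
Proof.
have pi0 : 0 < pi :> R by exact: pi_gt0.
move=> u0 u2; rewrite in_itv/= mulr_ge0//=; last by rewrite mulr_ge0// ltW.
have := ler_wpM2l (ltW pi0) u2; lra.
Qed.

(** Kronecker's theorem is proved with cosines; this translates its conclusion into a
    distance to the integers. *)
Lemma near_int_cos u rho : 0 < rho -> rho <= 2^-1 ->
  1 - cos (2 * pi * u) < 1 - cos (2 * pi * rho) -> near_int u rho.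
Proof.
move=> rho0 rho2; rewrite ltrD2l ltrN2 => cos_lt.
pose m := Num.floor (u + 2^-1); exists m.
have /andP[mu um] := floor_itv (u + 2^-1).
rewrite -/m intrD in um mu; set w := u - m%:~R.
have w2 : `|w| <= 2^-1 by rewrite ler_norml; apply/andP; split; rewrite /w; lra.
have pi0 : 0 < pi :> R by exact: pi_gt0.
have cosE : cos (2 * pi * u) = cos (2 * pi * `|w|).
  transitivity (cos (2 * pi * w)).
    by rewrite -[RHS](cosD2pi_int m) -mulrDr subrK.
  by case: (ger0P w) => // _; rewrite mulrN cosN.
move: cos_lt; rewrite cosE ltr_cos ?half_turn_itv// ?(ltW rho0)//.
by rewrite ltr_pM2l ?mulr_gt0// => /ltW.
Qed.

End NearInt.

(** The phases - i / K given to the independent elements are the ones whose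
    translates of a short arc cover the circle. *)
Lemma free_over_phases {R : realType} (F B : seq R) : (1 < size B)%N -> free_over F B ->
  exists t : R, [/\ 1 <= t, forall f, f \in F -> near_int (t * f) (size B)%:R^-1 &
    forall i, (i < size B)%N ->
      near_int (t * B`_i + i%:R / (size B)%:R) (size B)%:R^-1].
Proof.
set K := size B => K1 Bfree.
have K0 : 0 < K%:R :> R by rewrite ltr0n ltnW.
have pi0 : 0 < pi :> R by exact: pi_gt0.
have pi20 : 0 < 2 * pi :> R by rewrite mulr_gt0.
pose L1 : seq (R * R) := [seq (B`_i, 2 * pi * (i%:R / K%:R)) | i <- iota 0 K].
pose L := L1 ++ [seq (f, 0) | f <- F].
have L1B : [seq p.1 | p <- L1] = B by rewrite -map_comp; exact: mkseq_nth.
have Lrel c : zspan L (0, c) -> cos c = 1.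
  by move=> Lc; rewrite (@free_over_zspan _ F L1 c _ Lc) ?cos0// L1B.
have K2 : K%:R^-1 <= 2^-1 :> R by rewrite lef_pV2 ?posrE// ler_nat.
have eps0 : 0 < 1 - cos (2 * pi * K%:R^-1) :> R.
  rewrite subr_gt0 -[ltRHS]cos0 ltr_cos.
  - by rewrite mulr_gt0// invr_gt0.
  - by rewrite in_itv/= lexx ltW.
  - by apply: half_turn_itv; rewrite ?invr_ge0 ?(ltW K0).
have [s sT sL] := simultaneous_phases (2 * pi) Lrel eps0.
have sE : s = 2 * pi * (s / (2 * pi)) by rewrite mulrC divfK// gt_eqF.
exists (s / (2 * pi)); split.
- by rewrite ler_pdivlMr// mul1r.
- move=> f fF; apply: near_int_cos => //; first by rewrite invr_gt0.
  rewrite mulrA -sE -[s * f]addr0 [s * f]mulrC.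
  by apply: (sL (f, 0)); rewrite mem_cat; apply/orP; right; apply/mapP; exists f.
- move=> i iK; apply: near_int_cos => //; first by rewrite invr_gt0.
  rewrite mulrDr mulrA -sE [s * _]mulrC.
  apply: (sL (B`_i, 2 * pi * (i%:R / K%:R))); rewrite mem_cat; apply/orP; left.
  by apply/mapP; exists i => //; rewrite mem_iota.
Qed.

Lemma near_int_grid {R : realType} (u : R) (K : nat) : (0 < K)%N ->
  exists2 i, (i < K)%N & near_int (u - i%:R / K%:R) K%:R^-1.
Proof.
move=> K0; have KR : 0 < K%:R :> R by rewrite ltr0n.
have /andP[mu um] := floor_itv u; rewrite intrD in um.
set m := Num.floor u in mu um.
have v0 : 0 <= K%:R * (u - m%:~R) by rewrite mulr_ge0 ?(ltW KR)// subr_ge0.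
have /andP[iv vi] := truncn_itv v0.
set i := Num.truncn _ in iv vi; exists i.
  rewrite -(ltr_nat R); apply: le_lt_trans iv _.
  by rewrite gtr_pMr// ltrBlDl.
exists m; rewrite -(ler_pM2l KR) divff ?gt_eqF//.
have -> : K%:R * `|u - i%:R / K%:R - m%:~R| = `|K%:R * (u - m%:~R) - i%:R|.
  rewrite -[in LHS](gtr0_norm KR) -normrM (gtr0_norm KR); congr `|_|.
  by field; rewrite gt_eqF.
by rewrite -natr1 in vi; rewrite ger0_norm ?subr_ge0// lerBlDl ltW.
Qed.

(** From the new elements b in [n, n+1), every x reaches the set of y with t y almost
    an integer; from the old ones f < n, only those x reach it
    for which t x itself is close to an integer. *)
Lemma admissible_oscillating_block {R : realType} (L M : set R) (K n0 : nat) :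
  algebraically_independent L -> admissible M -> L `<=` M ->
  limn_esup (fun n : nat =>
    (counting (L `&` `[0%R, (n%:R : R)%R[) / (n%:R)%:E)%E : \bar R) = +oo%E ->
  (1 < K)%N ->
  exists (n : nat) (t : R), [/\ (n0 <= n)%N, 1 <= t,
    forall x, exists b, [/\ M b, n%:R <= b < n%:R + 1 & near_int (t * (x + b)) (2 / K%:R)] &
    forall x f, M f -> f < n%:R -> near_int (t * (x + f)) (2 / K%:R) ->
      near_int (t * x) (3 / K%:R)].
Proof.
move=> indL admM LM limsup K1.
have [n [F [B [n0n MF BM sB Bfree]]]] := admissible_free_block K n0 indL admM LM limsup.
have [|t [t1 tF tB]] := free_over_phases _ Bfree; first by rewrite sB.
rewrite sB in tF tB.
have K0 : (0 < K)%N by exact: ltnW.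
exists n, t; split => // [x|x f Mf fn].
  have [i iK xi] := near_int_grid (t * x) K0.
  have [|Mb nb] := BM B`_i; first by rewrite mem_nth// sB.
  exists B`_i; split => //.
  have := near_intD xi (tB i iK).
  by congr near_int; [ring|rewrite -mulr2n mulr_natl].
move=> /near_intD /(_ (near_intN (tF f (MF _ Mf fn)))).
by congr near_int; ring.
Qed.

(** * Outer Lebesgue measure and divergent sums of translates *)

Section OuterLebesgue.
Context {R : realType}.
Implicit Types (A B : set R).
Local Notation mu := (@completed_lebesgue_measure R).

(** The completed measure is the restriction of an outer measure defined on all sets,
    so that monotonicity and subadditivity hold without measurability. *)
Lemma completed_lebesgue_measure_le A B : A `<=` B -> (mu A <= mu B)%E.
Proof. by move=> AB; exact: (le_outer_measure ((@wlength R idfun)^*)%mu). Qed.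

Lemma completed_lebesgue_measure_bigcup (F : (set R)^nat) :
  (mu (\bigcup_i F i) <= \sum_(i <oo) mu (F i))%E.
Proof. exact: (outer_measure_sigma_subadditive ((@wlength R idfun)^*)%mu). Qed.

Lemma completed_lebesgue_measure_bigsetU (F : (set R)^nat) n :
  (mu (\big[setU/set0]_(i < n) F i) <= \sum_(i < n) mu (F i))%E.
Proof. exact: (outer_measure_subadditive ((@wlength R idfun)^*)%mu). Qed.

Lemma completed_lebesgue_measureU A B : (mu (A `|` B) <= mu A + mu B)%E.
Proof.
have := completed_lebesgue_measure_bigsetU (bigcup2 A B) 2.
by rewrite !big_ord_recr/= !big_ord0/= set0U add0e.
Qed.

Lemma completed_lebesgue_measure_itvcc (a b : R) : a <= b ->
  mu `[a, b]%classic = (b - a)%:E.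
Proof.
move=> ab; rewrite [LHS](_ : _ = lebesgue_measure `[a, b]%classic)//.
rewrite lebesgue_measure_itv/= lte_fin; by case: ltgtP ab => // -> _; rewrite subrr.
Qed.

(** On [2, 3] the product t x crosses at most t + 4 <= 5 t of the arcs of radius rho
    around the integers, and each crossing takes a time 2 rho / t. *)
Lemma near_int_measure_le (t rho : R) : 1 <= t -> 0 <= rho -> rho <= 1 ->
  (mu [set x : R | (2 <= x <= 3)%R /\ near_int (t * x)%R rho] <= (10 * rho)%:E)%E.
Proof.
move=> t1 rho0 rho1; have t0 : 0 < t by exact: lt_le_trans t1.
(* An integer within rho <= 1 of the interval [2 t, 3 t] is at least m0. *)
pose m0 := Num.floor (2 * t) - 1.
have /andP[m0l m0r] := floor_itv (2 * t).
have tl : (Num.truncn t)%:R <= t by have /andP[] := truncn_itv (ltW t0).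
have tr := truncnS_gt t.
pose N := (Num.truncn t + 4)%N.
pose I (j : nat) := `[((m0 + j%:Z)%:~R - rho) / t, ((m0 + j%:Z)%:~R + rho) / t]%classic.
apply: (@le_trans _ _ (mu (\big[setU/set0]_(j < N) I j))).
  apply: completed_lebesgue_measure_le => x /= [/andP[x2 x3] [m]].
  rewrite ler_norml => /andP[ml mr].
  have xt2 : 2 * t <= t * x by rewrite mulrC ler_pM2l.
  have xt3 : t * x <= 3 * t by rewrite [leRHS]mulrC ler_pM2l.
  have m0E : (Num.floor (2 * t))%:~R = m0%:~R + 1 :> R by rewrite -intrD1 subrK.
  rewrite intrD m0E in m0r; rewrite m0E in m0l.
  have m0m : m0 <= m by rewrite -(ler_int R); lra.
  have mN : m < m0 + N%:Z.
    rewrite -(ltr_int R) intrD /N PoszD intrD.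
    rewrite -natr1 in tr; rewrite -!pmulrn; lra.
  have jE : m = m0 + `|m - m0|%:Z by rewrite gez0_abs ?subr_ge0// subrKC.
  have jN : (`|m - m0| < N)%N by rewrite -ltz_nat gez0_abs ?subr_ge0// ltrBlDl.
  rewrite -bigcup_mkord; exists `|m - m0|%N => //=.
  rewrite /I -jE /= in_itv/= ler_pdivrMr// ler_pdivlMr// [x * t]mulrC.
  by apply/andP; split; lra.
apply: (le_trans (completed_lebesgue_measure_bigsetU _ _)).
rewrite (eq_bigr (fun=> (2 * rho / t)%:E)) => [|j _]; last first.
  rewrite /I completed_lebesgue_measure_itvcc.
    by congr EFin; field; rewrite gt_eqF.
  by rewrite ler_pM2r ?invr_gt0//; lra.
rewrite sumEFin sumr_const card_ord lee_fin -[_ *+ N]mulr_natl /N natrD.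
rewrite mulrA ler_pdivrMr//.
have : (Num.truncn t)%:R * rho <= t * rho by rewrite ler_wpM2r.
have : 1 * rho <= t * rho by rewrite ler_wpM2r.
lra.
Qed.

Lemma translate_sum_infinite (f : R -> R) (L A : set R) x :
  infinite_set A -> A `<=` L -> (forall a, A a -> f (x + a) = 1) ->
  translate_sum f L x = +oo%E.
Proof.
move=> infA AL fA; apply/eqyP => M M0.
have [B BA cB] := infinite_set_fset (Num.truncn M).+1 infA.
have MB : (M%:E <= #|` B|%fset%:R%:E)%E.
  by rewrite lee_fin ltW// (lt_le_trans (truncnS_gt M))// ler_nat.
apply: (le_trans MB).
apply: esum_ge; exists [set` B].
  by split; [exact: finite_fset|exact: subset_trans AL].
rewrite (eq_fsbigr (cst 1%E)) => [|a /set_mem aB]; last by rewrite fA//; exact: BA.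
by rewrite fsbig_finite//= set_fsetK card_fset_sum1 natr_sum -sumEFin.
Qed.

Lemma lebesgue_measurable_indic (U : set R) :
  measurable (U : set (measurableTypeR R)) -> lebesgue_measurable_fun (\1_U : R -> R).
Proof.
move=> mU; apply: (@measurable_realfun.measurable_indic _ (lebesgueTypeR R)).
exact: sub_caratheodory.
Qed.

Lemma measurable_oscillating_block (n : nat) (t rho : R) : 0 < t ->
  measurable ([set x : R | n%:R <= x < n%:R + 2 /\ near_int (t * x) rho] : set (measurableTypeR R)).
Proof.
move=> t0.
rewrite (_ : [set x : R | _] = `[n%:R, n%:R + 2[%classic `&`
    \bigcup_(m : int) `[(m%:~R - rho) / t, (m%:~R + rho) / t]%classic).
  apply: measurableI; first exact: measurable_itv.
  apply: countable_bigcupT_measurable => // m; exact: measurable_itv.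
have nearE x m : x \in `[(m%:~R - rho) / t, (m%:~R + rho) / t] = (`|t * x - m%:~R| <= rho).
  rewrite in_itv/= ler_pdivrMr// ler_pdivlMr// [x * t]mulrC ler_norml.
  by rewrite [in RHS]lerBlDl [in RHS]lerBrDl.
apply/seteqP; split => x /=; rewrite in_itv/=.
  by move=> [-> [m xm]]; split => //; exists m => //=; rewrite nearE.
by move=> [-> [m _ /=]]; rewrite nearE => xm; split => //; exists m.
Qed.

End OuterLebesgue.

(** * Convergence and divergence sets of positive measure *)

Theorem theorem2p6 (R : realType) (Lambda : set R)
    (Lambda_adm : admissible Lambda)
    (Lambda_indep : algebraically_independent Lambda)
    (Lambda_limsup :
      limn_esup (fun n : nat =>
        (counting (Lambda `&` `[0%R, (n%:R : R)%R[) / (n%:R)%:E)%E : \bar R) = +oo%E)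
    (Lambda' : set R) (Lambda'_adm : admissible Lambda')
    (sub_Lambda : Lambda `<=` Lambda') :
  type2 Lambda'.
Proof.
pose mu := @completed_lebesgue_measure R.
pose K k := (2 ^ (k + 6))%N.
have KR k : 0 < (K k)%:R :> R by rewrite ltr0n expn_gt0.
have blocks k : exists nt : nat * R, [/\ (k <= nt.1)%N, 1 <= nt.2,
    forall x, exists b, [/\ Lambda' b, nt.1%:R <= b < nt.1%:R + 1 &
      near_int (nt.2 * (x + b)) (2 / (K k)%:R)] &
    forall x f, Lambda' f -> f < nt.1%:R ->
      near_int (nt.2 * (x + f)) (2 / (K k)%:R) -> near_int (nt.2 * x) (3 / (K k)%:R)].
  have [|n [t h]] := @admissible_oscillating_block R Lambda Lambda' (K k) k
    Lambda_indep Lambda'_adm sub_Lambda Lambda_limsup.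
    by apply: (@leq_trans (2 ^ 6)%N) => //; rewrite leq_exp2l// leq_addl.
  by exists (n, t).
have /choice[nt ntP] := blocks.
pose n k := (nt k).1; pose t k := (nt k).2.
have t1 k : 1 <= t k by have [] := ntP k.
pose block k := [set x : R | (n k)%:R <= x < (n k)%:R + 2 /\
  near_int (t k * x) (2 / (K k)%:R)].
pose U := \bigcup_k block k.
pose exceptional k := [set x : R | 2 <= x <= 3 /\ near_int (t k * x) (3 / (K k)%:R)].
have div01 : `[0, 1]%classic `<=` divergence_set (\1_U : R -> R) Lambda'.
  move=> x /=; rewrite in_itv/= => /andP[x0 x1].
  apply: (@translate_sum_infinite _ _ _ [set b | Lambda' b /\ U (x + b)]).
  (* The elements b hit by x are unbounded, as the k-th block supplies one that is
     at least k. *)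
  - move=> finA.
    have [N AN] : exists N : nat, forall b, Lambda' b -> U (x + b) -> b < N%:R.
      have /finite_seqP[s sA] := finA.
      exists (\max_(b <- s) (Num.truncn b).+1)%N => b Mb Ub.
      have bs : b \in s by have /= := congr1 (fun A : set R => A b) sA; move=> <-.
      apply: lt_le_trans (truncnS_gt b) _; rewrite ler_nat.
      by rewrite (big_rem b)//= leq_maxl.
    have [kn _ /(_ x)[b [Mb /andP[nb bn] tb]] _] := ntP N.
    suff : b < N%:R by rewrite ltNge (le_trans _ nb)// ler_nat.
    apply: AN => //; exists N => //; split => //.
    by apply/andP; split; rewrite /n; lra.
  - by move=> b [].
  - by move=> b [_ Ub]; rewrite indicE mem_set.
have conv23 : `[2, 3]%classic `\` \bigcup_k exceptional k `<=`
    convergence_set (\1_U : R -> R) Lambda'.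
  move=> x [/= +  notE]; rewrite in_itv/= => /andP[x2 x3].
  rewrite /convergence_set/= /translate_sum esum1 ?ltry// => b Mb.
  congr EFin; rewrite indicE memNset//= => -[k _ [/andP[nxb xbn] txb]].
  apply: notE; exists k => //; split; first by rewrite x2.
  have [_ _ _ miss] := ntP k; apply: (miss x b Mb _ txb).
  by rewrite -/(n k); lra.
have mU : lebesgue_measurable_fun (\1_U : R -> R).
  apply: lebesgue_measurable_indic; apply: bigcupT_measurable => k.
  by apply: measurable_oscillating_block; apply: lt_le_trans (t1 k).
have U0 x : 0 <= (\1_U : R -> R) x by rewrite indicE.
move=> /(_ _ mU U0)[D0|C0].
  have := completed_lebesgue_measure_le div01.
  by rewrite D0 completed_lebesgue_measure_itvcc// subr0 lee_fin ler10.
(* The k-th exceptional set has measure at most 30 / 2^(k+6) = (30 / 32) / 2^(k+1). *)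
pose e : R := 30 / 32.
have mE : (mu (\bigcup_k exceptional k) <= e%:E)%E.
  apply: (le_trans (completed_lebesgue_measure_bigcup _)).
  have e0 : 0 <= e by rewrite /e; lra.
  apply: (le_trans _ (epsilon_trick0 xpredT e0)).
  apply: lee_nneseries => // k _.
  have rho0 : 0 <= 3 / (K k)%:R :> R by rewrite divr_ge0// ltW.
  have rho1 : 3 / (K k)%:R <= 1 :> R.
    rewrite ler_pdivrMr// mul1r ler_nat.
    by apply: (@leq_trans (2 ^ 6)%N) => //; rewrite leq_exp2l// leq_addl.
  apply: (le_trans (near_int_measure_le (t1 k) rho0 rho1)).
  rewrite lee_fin /e /K (_ : (k + 6 = k.+1 + 5)%N); last by rewrite addSnnS.
  rewrite expnD natrM (_ : (2 ^ 5)%N = 32%N)//; set p := (2 ^ k.+1)%:R.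
  have p0 : p != 0 :> R by rewrite pnatr_eq0 -lt0n expn_gt0.
  by rewrite le_eqVlt; apply/orP; left; apply/eqP; field.
have cover : `[2, 3]%classic `<=`
    \bigcup_k exceptional k `|` convergence_set (\1_U : R -> R) Lambda'.
  move=> x x23; have [xE|xE] := pselect ((\bigcup_k exceptional k) x); first by left.
  by right; apply: conv23.
have := le_trans (completed_lebesgue_measure_le cover) (completed_lebesgue_measureU _ _).
rewrite completed_lebesgue_measure_itvcc ?ler_nat// C0 adde0 => /le_trans/(_ mE).
by rewrite lee_fin /e; lra.
Qed.
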